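(* Let $G$ be a compact (Hausdorff) group and let $K$ be a closed subgroup of $G$. Then $Pr(\langle x\rangle,G)>0$ for every $x\in K$ if and only if $G$ has an open normal subgroup $T$ such that $K/C_K(T)$ is a torsion group.
   Context: For a closed subgroup $H$ of a compact group $G$, $Pr(H,G)$ denotes the probability that a random element of $H$ commutes with a random element of $G$, i.e. $Pr(H,G)=(\mu_H\times\mu_G)(\{(h,g)\in H\times G: hg=gh\})$, where $\mu_H,\mu_G$ are the normalized Haar measures on $H$ and $G$. For $x\in G$, $\langle x\rangle$ denotes the closed subgroup of $G$ topologically generated by $x$ (the monothetic subgroup generated by $x$). $C_K(T)=\{k\in K: kt=tk \text{ for all } t\in T\}$. *)

(* Defs.v *)
From HB Require Import structures.
From mathcomp Require Import all_boot all_order all_algebra.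
From mathcomp Require Import all_classical all_reals all_analysis.
From Stdlib Require ClassicalEpsilon.

Set Implicit Arguments.
Unset Strict Implicit.
Unset Printing Implicit Defensive.

Import Order.TTheory GRing.Theory Num.Theory.
Local Open Scope classical_set_scope.
Local Open Scope ring_scope.

Section Groups.
Variable (G : topologicalType) (mul : G -> G -> G) (inv : G -> G) (one : G).

Definition compact_group : Prop :=
  (forall x y z, mul x (mul y z) = mul (mul x y) z) /\
  (forall x, mul one x = x /\ mul x one = x) /\
  (forall x, mul (inv x) x = one /\ mul x (inv x) = one) /\
  continuous (fun p : G * G => mul p.1 p.2) /\
  continuous inv /\
  compact [set: G] /\
  hausdorff_space G.

Definition subgroup (H : set G) : Prop :=
  [/\ H one, (forall x y, H x -> H y -> H (mul x y)) & (forall x, H x -> H (inv x))].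

Definition closed_subgroup (H : set G) : Prop := subgroup H /\ closed H.

Definition normal_subgroup (H : set G) : Prop :=
  subgroup H /\ (forall g h, H h -> H (mul (mul g h) (inv g))).

Definition gpow (x : G) (n : nat) : G := iter n (mul x) one.
Definition zpow (x : G) (z : int) : G :=
  match z with Posz n => gpow x n | Negz n => inv (gpow x n.+1) end.

Definition monothetic (x : G) : set G := closure [set zpow x z | z in [set: int]].

Definition centralizer_in (K T : set G) : set G :=
  [set k | K k /\ forall t, T t -> mul k t = mul t k].

(* K / N is a torsion group (N a normal subgroup of K): every coset kN
   has finite order, i.e. k^n \in N for some n >= 1 *)
Definition quotient_torsion (K N : set G) : Prop :=
  forall k, K k -> exists n : nat, (0 < n)%N /\ N (gpow k n).

Definition borel : set (set G) := <<s open >>.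

(* A normalized Haar measure of the closed subgroup H, viewed as a
   (Radon) Borel probability measure on G concentrated on H and
   invariant under left translation by elements of H. *)
Definition haar_measure (R : realType) (H : set G) (mu : set G -> R) : Prop :=
  (forall A, borel A -> 0 <= mu A) /\
      (forall F : nat -> set G, (forall n, borel (F n)) -> trivIset setT F ->
          ((fun n : nat => \sum_(0 <= i < n) mu (F i) : R) @ \oo --> (mu (\bigcup_n F n) : R^o))) /\
      mu [set: G] = 1 /\
      mu H = 1 /\
      (forall h A, H h -> borel A -> mu [set mul h a | a in A] = mu A) /\
      (forall A, borel A -> forall e : R, 0 < e ->
          exists U, [/\ open U, (A `<=` U) & (mu U <= mu A + e)]) /\
      (forall U, open U -> forall e : R, 0 < e ->
          exists Kc, [/\ compact Kc, (Kc `<=` U) & (mu U <= mu Kc + e)]).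

End Groups.

Definition pmul (G : topologicalType) (mul : G -> G -> G) (p q : G * G) : G * G :=
  (mul p.1 q.1, mul p.2 q.2).
Definition pinv (G : topologicalType) (inv : G -> G) (p : G * G) : G * G :=
  (inv p.1, inv p.2).

(* The normalized Haar measure mu_H x mu_G, taken as the normalized Haar
   measure of the compact group H x G (closed subgroup of G x G). *)
Definition haar_prod (R : realType) (G : topologicalType) (mul : G -> G -> G)
  (inv : G -> G) (one : G) (H : set G) : set (G * G) -> R :=
  ClassicalEpsilon.epsilon (inhabits (fun _ => 0))
    (fun nu => haar_measure (pmul mul) [set p | H p.1] nu).

Definition Pr (R : realType) (G : topologicalType) (mul : G -> G -> G)
  (inv : G -> G) (one : G) (H : set G) : R :=
  haar_prod R mul inv one H [set p | H p.1 /\ mul p.1 p.2 = mul p.2 p.1].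

(* Main.v *)
Require Import Defs.
From HB Require Import structures.
From mathcomp Require Import all_boot all_order all_algebra.
From mathcomp Require Import all_classical all_reals all_analysis.

Set Implicit Arguments.
Unset Strict Implicit.
Unset Printing Implicit Defensive.

Import Order.TTheory GRing.Theory Num.Theory.
Import numFieldNormedType.Exports.

Local Open Scope classical_set_scope.
Local Open Scope ring_scope.

(** [Pr] is a Hilbert choice, so a Haar measure has to be constructed first: the
    covering ratios [(A : U) / (H : U)] converge along an ultrafilter of
    neighbourhoods [U] shrinking to the identity, the limit is an additive content
    on closed sets, and Caratheodory's theorem turns it into a Radon measure.

    Positivity of [Pr <x> G] is then equivalent to [C_G(x^n)] being open for some
    [n >= 1].  If it is open, finitely many translates of the set [P] of commuting
    pairs cover [<x> * G].  Otherwise the union [E] of all [C_G(x^n)] has infinite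
    index, because if it had finite index some [G * C_G(x^n)] would have positive
    measure; for [g_i] in distinct cosets of [E], the translates
    [(1, g_i) P] overlap in sets [C_<x>(g_i^-1 g_j) * G], which are null since no
    power of [x] commutes with [g_i^-1 g_j]; so infinitely many copies of [P] fit into
    mass [1].

    It remains to find one open normal [T] for all [x] in [K].  If there is none, one
    builds commuting [z_1, z_2, ...] in [K] converging so fast to the identity that,
    for every [n], the number of conjugates of [(z_1 ... z_k)^n] grows with [k] and
    the conjugates found so far stay distinct in the limit: [z_{k+1}] is taken in the
    normal core [T] of [C_G(z_1 ... z_k)] with no power centralizing [T].  No power of
    a limit point has an open centralizer. *)

(** * Compact groups *)

(** Dependent choice against all earlier terms at once: a choice function on finite lists is
    iterated, each new term being appended to the list. *)
Lemma greedy_sequence (T : choiceType) (P : T -> Prop) (r : T -> T -> Prop) :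
  (forall s : seq T, (forall a, a \in s -> P a) ->
     exists g, P g /\ forall a, a \in s -> r a g) ->
  exists f : nat -> T, (forall i, P (f i)) /\ forall i j, (i < j)%N -> r (f i) (f j).
Proof.
move=> ext.
have /choice[next nextP] : forall s : seq T, exists y, (forall a, a \in s -> P a) ->
    P y /\ forall a, a \in s -> r a y.
  move=> s; have [sP|sP] := pselect (forall a, a \in s -> P a).
    by have [g ?] := ext s sP; exists g.
  (* A list outside [P] gets an arbitrary value, borrowed from the extension of the empty list. *)
  by have [g _] := ext [::] (fun a h => False_ind _ (notF h)); exists g.
pose F := fix F n := if n is m.+1 then rcons (F m) (next (F m)) else [::].
have FP n a : a \in F n -> P a.
  elim: n a => [//|n IH] a /=; rewrite mem_rcons inE => /orP[/eqP->|/IH//].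
  by have [] := nextP _ IH.
have Fmem i j : (i < j)%N -> next (F i) \in F j.
  elim: j => [//|j IH]; rewrite ltnS leq_eqVlt => /orP[/eqP->|/IH] /=.
    by rewrite mem_rcons mem_head.
  by rewrite mem_rcons inE => ->; rewrite orbT.
exists (next \o F); split=> [i|i j ij] /=; first by have [] := nextP _ (@FP i).
by have [_] := nextP _ (@FP j); apply; exact: Fmem.
Qed.

Lemma near_neq (X Y : topologicalType) (f g : X -> Y) (x : X) :
  hausdorff_space Y -> {for x, continuous f} -> {for x, continuous g} ->
  f x <> g x -> \forall y \near x, f y <> g y.
Proof.
rewrite open_hausdorff => hY cf cg /eqP /hY[[A B] /= [xA xB] [oA oB /eqP AB0]].
rewrite inE in xA; rewrite inE in xB.
have fA : \forall y \near x, A (f y) by exact: cf _ (open_nbhs_nbhs (conj oA xA)).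
have gB : \forall y \near x, B (g y) by exact: cg _ (open_nbhs_nbhs (conj oB xB)).
apply: (filterS2 _ _ fA gB) => y Ay By fg.
suff : (A `&` B) (f y) by rewrite AB0.
by split=> //; rewrite fg.
Qed.

Lemma closed_equalizer (X Y : topologicalType) (f g : X -> Y) :
  hausdorff_space Y -> continuous f -> continuous g ->
  closed [set x | f x = g x].
Proof.
move=> hY cf cg; rewrite -[X in closed X]setCK; apply: open_closedC.
rewrite openE => x /=; exact: near_neq hY (cf x) (cg x).
Qed.

Lemma near_seq (T : Type) (I : eqType) (F : set_system T) (s : seq I)
    (P : I -> T -> Prop) : Filter F ->
  (forall i, i \in s -> \forall x \near F, P i x) ->
  \forall x \near F, forall i, i \in s -> P i x.
Proof.
move=> FF; elim: s => [|a s IH] sP; first exact: nearW.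
have aP := sP a (mem_head _ _).
have := IH (fun i si => sP i (mem_behead (s := a :: s) si)).
move=> {}IH; apply: (filterS2 _ _ aP IH) => x Pa Ps i; rewrite inE => /orP[/eqP->//|]; exact: Ps.
Qed.

Section GroupLaws.
Context (G : topologicalType) (mul : G -> G -> G) (inv : G -> G) (one : G).
Hypothesis HG : compact_group mul inv one.

Local Notation "x ** y" := (mul x y) (at level 40, left associativity).
Local Notation gpow := (gpow mul one).

Lemma grpA x y z : x ** (y ** z) = x ** y ** z.
Proof. by case: HG => + _; apply. Qed.
Lemma grp1l x : one ** x = x.
Proof. by case: HG => _ [/(_ x)[]]. Qed.
Lemma grp1r x : x ** one = x.
Proof. by case: HG => _ [/(_ x)[]]. Qed.
Lemma grpVl x : inv x ** x = one.
Proof. by case: HG => _ [_ [/(_ x)[]]]. Qed.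
Lemma grpVr x : x ** inv x = one.
Proof. by case: HG => _ [_ [/(_ x)[]]]. Qed.
Lemma grp_mul_continuous : continuous (fun p : G * G => p.1 ** p.2).
Proof. by case: HG => _ [_ [_ []]]. Qed.
Lemma grp_inv_continuous : continuous inv.
Proof. by case: HG => _ [_ [_ [_ []]]]. Qed.
Lemma grp_compact : compact [set: G].
Proof. by case: HG => _ [_ [_ [_ [_ []]]]]. Qed.
Lemma grp_hausdorff : hausdorff_space G.
Proof. by case: HG => _ [_ [_ [_ [_ []]]]]. Qed.

Lemma grpK x y : inv x ** (x ** y) = y.
Proof. by rewrite grpA grpVl grp1l. Qed.
Lemma grpVK x y : x ** (inv x ** y) = y.
Proof. by rewrite grpA grpVr grp1l. Qed.
Lemma grprK x y : y ** x ** inv x = y.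
Proof. by rewrite -grpA grpVr grp1r. Qed.
Lemma grprVK x y : y ** inv x ** x = y.
Proof. by rewrite -grpA grpVl grp1r. Qed.
Lemma grpI x y z : x ** y = x ** z -> y = z.
Proof. by move=> /(congr1 (mul (inv x))); rewrite !grpK. Qed.
Lemma grpIr x y z : y ** x = z ** x -> y = z.
Proof. by move=> /(congr1 (mul^~ (inv x))); rewrite !grprK. Qed.
Lemma grp_invK x : inv (inv x) = x.
Proof. by apply: (@grpI (inv x)); rewrite grpVr grpVl. Qed.
Lemma grp_inv1 : inv one = one.
Proof. by apply: (@grpI one); rewrite grpVr grp1l. Qed.
Lemma grp_invM x y : inv (x ** y) = inv y ** inv x.
Proof. by apply: (@grpI (x ** y)); rewrite grpVr grpA grprK grpVr. Qed.

Lemma grp_commV x y : x ** y = y ** x -> inv x ** y = y ** inv x.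
Proof. by move=> xy; apply: (@grpI x); rewrite grpVK grpA xy grprK. Qed.
Lemma grp_commM x y z : x ** z = z ** x -> y ** z = z ** y ->
  (x ** y) ** z = z ** (x ** y).
Proof. by move=> xz yz; rewrite -grpA yz grpA xz grpA. Qed.

Lemma gpowS x n : gpow x n.+1 = x ** gpow x n. Proof. by []. Qed.
Lemma gpowD x m n : gpow x (m + n) = gpow x m ** gpow x n.
Proof. by elim: m => [|m IH]; rewrite ?grp1l// addSn !gpowS IH grpA. Qed.
Lemma gpowM x m n : gpow x (m * n) = gpow (gpow x m) n.
Proof.
by elim: n => [|n IH]; [rewrite muln0|rewrite mulnS gpowD IH gpowS].
Qed.
Lemma gpow_comm x y n : x ** y = y ** x -> gpow x n ** y = y ** gpow x n.
Proof.
move=> xy; elim: n => [|n IH]; first by rewrite grp1l grp1r.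
by rewrite gpowS; exact: grp_commM.
Qed.
Lemma gpowMn x y n : x ** y = y ** x -> gpow (x ** y) n = gpow x n ** gpow y n.
Proof.
move=> xy; elim: n => [|n IH]; first by rewrite grp1l.
by rewrite !gpowS IH !grpA -(grpA x y) -(gpow_comm n xy) grpA.
Qed.

Lemma continuous_mulG (X : topologicalType) (f g : X -> G) :
  continuous f -> continuous g -> continuous (fun x => f x ** g x).
Proof.
move=> cf cg x.
apply: (@continuous_comp _ _ _ (fun x => (f x, g x)) (fun p => p.1 ** p.2)).
  exact: (cvg_pair (cf x) (cg x)).
exact: grp_mul_continuous.
Qed.
Lemma continuous_invG (X : topologicalType) (f : X -> G) :
  continuous f -> continuous (fun x => inv (f x)).
Proof.
by move=> cf x; apply: (@continuous_comp _ _ _ f inv); [exact: cf|exact: grp_inv_continuous].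
Qed.
Lemma continuous_lmul a : continuous (mul a).
Proof. by apply: continuous_mulG; [exact: cst_continuous|move=> ?; exact: cvg_id]. Qed.
Lemma continuous_gpow n : continuous (gpow^~ n).
Proof.
elim: n => [|n IH]; first exact: cst_continuous.
by apply: (@continuous_mulG _ idfun (gpow^~ n)) => // ?; exact: cvg_id.
Qed.
Lemma continuous_conj g : continuous (fun y => g ** y ** inv g).
Proof.
apply: continuous_mulG; last exact: cst_continuous.
exact: continuous_lmul.
Qed.

Lemma image_lmul a (A : set G) : [set a ** b | b in A] = mul (inv a) @^-1` A.
Proof.
apply/seteqP; split=> [_ [b Ab <-]|b Ab] /=; first by rewrite grpK.
by exists (inv a ** b) => //; rewrite grpVK.
Qed.

Lemma closed_lmul a (A : set G) : closed A -> closed [set a ** b | b in A].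
Proof.
by rewrite image_lmul => cA; apply: closed_comp => // ? _; exact: continuous_lmul.
Qed.

Lemma nbhs_lmul a (A : set G) : nbhs one A -> nbhs a [set a ** b | b in A].
Proof.
rewrite image_lmul => A1.
have := @continuous_lmul (inv a) a; rewrite /continuous_at grpVl; exact.
Qed.

Lemma subgroup_open (A : set G) : subgroup mul inv one A -> nbhs one A -> open A.
Proof.
move=> [A1 AM AV] nA; rewrite openE => a Aa.
apply: filterS (nbhs_lmul a nA) => _ [b Ab <-]; exact: AM.
Qed.

(** By compactness [f] has a cluster point [p], and [inv p ** p = one]; two terms close enough to
    [p] then differ by an element of [U]. *)
Lemma sequence_recurs (f : nat -> G) (U : set G) : nbhs one U ->
  exists i j, (i < j)%N /\ U (inv (f i) ** f j).
Proof.
move=> U1.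
have [p [_ pf]] := @grp_compact (f @ \oo) _ filterT.
have : (fun q : G * G => inv q.1 ** q.2) @ (p, p) --> nbhs one.
  rewrite -(grpVl p).
  have := @continuous_mulG _ (fun q : G * G => inv q.1) (fun q : G * G => q.2) _ _ (p, p).
  apply; last by move=> q; exact: cvg_snd.
  by apply: continuous_invG => q; exact: cvg_fst.
move=> /(_ _ U1)[[A B] /= [pA pB] AB].
have fA N : exists n, (N <= n)%N /\ (A `&` B) (f n).
  have /(_ (f @` [set n | (N <= n)%N]) (A `&` B))[] := pf.
  - by exists N => // n /= Nn; exists n.
  - exact: filterI.
  by move=> _ [[n Nn <-] ABn]; exists n.
have [i [_ [Ai _]]] := fA 0%N.
have [j [ij [_ Bj]]] := fA i.+1.
by exists i, j; split=> //; exact: (AB (f i, f j)).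
Qed.

(** Otherwise a greedy sequence in [P] would violate [sequence_recurs]. *)
Lemma finite_translate_cover (P U : set G) : nbhs one U ->
  exists2 s : seq G, (forall a, a \in s -> P a) &
    forall g, P g -> exists2 a, a \in s & U (inv a ** g).
Proof.
move=> U1; apply: contrapT => nfin.
have [|f [_ fU]] := @greedy_sequence _ P (fun a g => ~ U (inv a ** g)).
  move=> s sP; apply: contrapT => nex; apply: nfin; exists s => // g Pg.
  apply: contrapT => nU; apply: nex; exists g; split=> // a sa Ua.
  by apply: nU; exists a.
by have [i [j [ij]]] := sequence_recurs f U1; exact: fU.
Qed.

Lemma gpow_recurs x (U : set G) : nbhs one U -> exists2 n, (0 < n)%N & U (gpow x n).
Proof.
move=> /(sequence_recurs (gpow x))[i [j [ij]]].
rewrite -(subnKC (ltnW ij)) gpowD grpK => ?; exists (j - i)%N => //.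
by rewrite subn_gt0.
Qed.

(** The tube lemma. It supplies the neighbourhoods below that serve all group elements at once. *)
Lemma tube (I : Type) (F : set_system I) (P : G -> I -> Prop) : Filter F ->
  (forall g : G, \forall h \near g & y \near F, P h y) ->
  \forall y \near F, forall g, P g y.
Proof.
move=> FF Pn; have /compact_near_coveringP := grp_compact.
move=> /(_ _ F (fun y g => P g y) FF (fun g _ => Pn g)).
by apply: filterS => y yP g; exact: yP.
Qed.

End GroupLaws.

(** * Conjugates and centralizers *)

Section Conjugates.
Context (G : topologicalType) (mul : G -> G -> G) (inv : G -> G) (one : G).
Hypothesis HG : compact_group mul inv one.

Local Notation "x ** y" := (mul x y) (at level 40, left associativity).
Local Notation gpow := (gpow mul one).
Local Notation subgroup := (subgroup mul inv one).

Definition commutant (y : G) : set G := [set g | g ** y = y ** g].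

Lemma subgroup_commutant y : subgroup (commutant y).
Proof.
split=> [|a b|a]; rewrite /commutant /= ?(grp1l HG) ?(grp1r HG)//.
  exact: (grp_commM HG).
exact: (grp_commV HG).
Qed.

Lemma closed_commutant y : closed (commutant y).
Proof.
apply: (closed_equalizer (grp_hausdorff HG)); last exact: (continuous_lmul HG).
by apply: (continuous_mulG HG); [move=> ?; exact: cvg_id|exact: cst_continuous].
Qed.

Lemma commutant_gpow y n : commutant y `<=` commutant (gpow y n).
Proof. by move=> g gy; apply/esym/(gpow_comm HG)/esym. Qed.

Lemma commutantM x y : commutant x `&` commutant y `<=` commutant (x ** y).
Proof. by move=> g [gx gy]; apply/esym/(grp_commM HG); apply/esym. Qed.

Definition normal_core (A : set G) : set G := [set t | forall g, A (g ** t ** inv g)].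

Lemma normal_core_sub A : normal_core A `<=` A.
Proof. by move=> t /(_ one); rewrite (grp1l HG) (grp_inv1 HG) (grp1r HG). Qed.

Lemma normal_core_normal A : subgroup A -> normal_subgroup mul inv one (normal_core A).
Proof.
move=> [A1 AM AV]; split; first split=> [g|x y Ax Ay g|x Ax g].
- by rewrite (grp1r HG) (grpVr HG).
- by have := AM _ _ (Ax g) (Ay g); rewrite !(grpA HG) (grprVK HG).
- by have := AV _ (Ax g); rewrite !(grp_invM HG) (grp_invK HG) (grpA HG).
by move=> g h Ah k; have := Ah (k ** g); rewrite (grp_invM HG) !(grpA HG).
Qed.

(** Conjugation is jointly continuous at each [(g, one)], and the tube lemma removes the dependence
    on [g]. This is why the core of an open subgroup is open. *)
Lemma conj_near1 (A : set G) : nbhs one A ->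
  \forall y \near one, forall g, A (g ** y ** inv g).
Proof.
move=> A1; apply: (tube HG) => g.
have : (fun p : G * G => p.1 ** p.2 ** inv p.1) @ (g, one) --> nbhs one.
  rewrite -{2}(grpVr HG g) -{2}(grp1r HG g).
  have c : continuous (fun p : G * G => p.1 ** p.2 ** inv p.1).
    apply: (continuous_mulG HG); first exact: (grp_mul_continuous HG).
    by apply: (continuous_invG HG) => p; exact: cvg_fst.
  exact: (c (g, one)).
exact.
Qed.

Lemma normal_core_open A : subgroup A -> nbhs one A -> open (normal_core A).
Proof.
move=> sA nA; apply: (subgroup_open HG); first by case: (normal_core_normal sA).
exact: conj_near1.
Qed.

(** A lower bound on the size of the conjugacy class of [y], witnessed by conjugating elements so
    that one list can serve every [z] close to [y]. *)
Definition has_conjugates (y : G) (c : nat) : Prop :=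
  exists s : seq G, size s = c /\ uniq [seq g ** y ** inv g | g <- s].

(** The conjugate of [y] by [g] depends only on the left coset of [commutant y] containing [g], and
    finitely many cosets cover a compact group. *)
Lemma conjugates_finite y : nbhs one (commutant y) ->
  exists N, forall c, has_conjugates y c -> (c <= N)%N.
Proof.
move=> /(finite_translate_cover HG setT)[s _ sP].
exists (size s) => _ [s' [<- us']].
rewrite -(size_map (fun g => g ** y ** inv g) s') -(size_map (fun g => g ** y ** inv g) s).
apply: uniq_leq_size us' _ => _ /mapP[g _ ->].
have [a sa ay] := sP g Logic.I; apply/mapP; exists a => //.
rewrite -[g in LHS](grpVK HG a); move: (inv a ** g) ay => h hy.
by rewrite (grp_invM HG) !(grpA HG) -(grpA HG a h y) hy !(grpA HG) (grprK HG).
Qed.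

Lemma near_uniq_conjugates (s : seq G) (y : G) :
  uniq [seq g ** y ** inv g | g <- s] ->
  \forall z \near y, uniq [seq g ** z ** inv g | g <- s].
Proof.
elim: s => [|a s IH] /=; first by move=> _; exact: nearW.
case/andP=> ays /IH us.
have aP : \forall z \near y, forall g, g \in s -> a ** z ** inv a <> g ** z ** inv g.
  apply: near_seq => g gs.
  apply: (near_neq (grp_hausdorff HG)); try exact: (continuous_conj HG).
  by move=> e; move: ays; rewrite e map_f.
apply: (filterS2 _ _ aP us) => z az ->; rewrite andbT.
by apply/mapP => -[g gs /az].
Qed.

Lemma near_has_conjugates (y : G) c : has_conjugates y c ->
  \forall z \near y, has_conjugates z c.
Proof.
move=> [s [sc us]]; apply: filterS (near_uniq_conjugates us) => z uz.
by exists s.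
Qed.

(* For [w] close to [one] the conjugates of [y ** w] stay close to those of [y],
   uniformly in the conjugating element; an element [t] commuting with [y] but
   not with [w] splits one of them in two. *)
Lemma has_conjugates_split (y : G) c : has_conjugates y c ->
  \forall w \near one, forall t, t ** y = y ** t -> t ** w <> w ** t ->
    has_conjugates (y ** w) c.+1.
Proof.
move=> [[|a s] [<- us]].
  (* With [c = 0], any single conjugate suffices. *)
  by apply: nearW => w t _ _; exists [:: one].
have uw : \forall w \near one, uniq [seq g ** (y ** w) ** inv g | g <- a :: s].
  have := @continuous_lmul _ _ _ _ HG y one; rewrite /continuous_at (grp1r HG).
  by move=> /(_ _ (near_uniq_conjugates us)).
(* By the tube lemma the neighbourhood of [w] does not depend on [t]; at [w = one] the two sides are
   the conjugates of [y] by [a] and by [g], which differ. *)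
have aw : \forall w \near one, forall g, g \in s ->
    forall t, a ** (y ** (t ** w ** inv t)) ** inv a <> g ** (y ** w) ** inv g.
  apply: near_seq => g gs; apply: (tube HG) => t.
  apply: (@near_neq (G * G)%type G (fun p => a ** (y ** (p.1 ** p.2 ** inv p.1)) ** inv a)
    (fun p => g ** (y ** p.2) ** inv g) (t, one) (grp_hausdorff HG)).
  - apply: (continuous_mulG HG); last exact: cst_continuous.
    apply: (continuous_mulG HG); first exact: cst_continuous.
    apply: (continuous_mulG HG); first exact: cst_continuous.
    apply: (continuous_mulG HG); first exact: (grp_mul_continuous HG).
    by apply: (continuous_invG HG) => p; exact: cvg_fst.
  - apply: (continuous_mulG HG); last exact: cst_continuous.
    apply: (continuous_mulG HG); first exact: cst_continuous.
    apply: (continuous_mulG HG); first exact: cst_continuous.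
    by move=> p; exact: cvg_snd.
  - rewrite /= !(grp1r HG) (grpVr HG) (grp1r HG) => e.
    by move: us => /=; rewrite e map_f.
apply: (filterS2 _ _ uw aw) => w {}uw {}aw t ty tw.
have ct : (a ** t) ** (y ** w) ** inv (a ** t) = a ** (y ** (t ** w ** inv t)) ** inv a.
  by rewrite (grp_invM HG) !(grpA HG) -(grpA HG a t y) ty !(grpA HG).
(* The extra conjugating element is [a ** t]; its conjugate of [y ** w] agrees with the one by [a]
   only if [t] commutes with [w]. *)
exists [:: a ** t, a & s]; split=> //=; move: uw => /= ->; rewrite andbT.
rewrite inE negb_or ct; apply/andP; split; last first.
  by apply/mapP => -[g /aw]; exact.
apply/eqP => /(grpIr HG)/(grpI HG)/(grpI HG) e; apply: tw.
by rewrite -{2}e (grprVK HG).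
Qed.

End Conjugates.

(** * Powers of elements of [K] centralizing a common open normal subgroup *)

Section UniformCentralizer.
Context (G : topologicalType) (mul : G -> G -> G) (inv : G -> G) (one : G).
Hypothesis HG : compact_group mul inv one.
Context (K : set G).
Hypothesis HK : closed_subgroup mul inv one K.

Local Notation "x ** y" := (mul x y) (at level 40, left associativity).
Local Notation gpow := (gpow mul one).
Local Notation commutant := (commutant mul).
Local Notation has_conjugates := (has_conjugates mul inv).

(** [Kfc] is what positivity of [Pr] provides; [Knt] is the negation of the conclusion of
    [uniform_centralizer], to be refuted. *)
Hypothesis Kfc : forall x, K x -> exists2 n, (0 < n)%N & nbhs one (commutant (gpow x n)).
Hypothesis Knt : forall T, open T -> normal_subgroup mul inv one T ->
  exists2 z, K z & forall n, (0 < n)%N -> exists2 t, T t & t ** gpow z n <> gpow z n ** t.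

(* [p.1] is the product of the first [k] elements and [p.2] a closed neighbourhood of
   it that contains all later products; the subtraction is truncated, so the last
   condition is void for [n >= k]. *)
Definition stage (k : nat) (p : G * set G) : Prop :=
  [/\ K p.1, nbhs one (commutant p.1), nbhs p.1 p.2, closed p.2 &
    forall y, p.2 y -> forall n, (0 < n)%N -> has_conjugates (gpow y n) (k - n)].

Lemma stage0 : stage 0 (one, setT).
Proof.
case: HK => -[K1 KM KV] cK; split=> //=.
- by apply: nearW => g; rewrite /Defs.gpow /commutant /= (grp1l HG) (grp1r HG).
- exact: filterT.
by move=> y _ n _; exists [::]; rewrite sub0n.
Qed.

(** The new product is [x ** z] with [z] the power of [z0] of exponent [j * i]: no positive power of
    [z0] centralizes the core [T], [j] makes the centralizer of [z] open, and [i] brings [z] into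
    [T] and close to [one]. As [z] commutes with [x], powers of [x ** z] split, and an element of
    [T] that commutes with [gpow x n] but not with [gpow z n] adds one conjugate. *)
Lemma stageS k p : stage k p -> exists q, stage k.+1 q /\ q.2 `<=` p.2.
Proof.
case: HK => -[K1 KM KV] cK.
case: p => x W [/= Kx Fx Wx cW WP].
pose T := normal_core mul inv (commutant x).
have sC := subgroup_commutant HG x.
have oT : open T := normal_core_open HG sC Fx.
have nT : normal_subgroup mul inv one T := normal_core_normal HG sC.
have TC t : T t -> t ** x = x ** t := @normal_core_sub _ _ _ _ HG _ t.
have T1 : nbhs one T by apply: open_nbhs_nbhs; split=> //; case: nT => -[].
have [z0 Kz0 z0P] := Knt oT nT.
have Kpow y n : K y -> K (gpow y n).
  by move=> Ky; elim: n => [//|n IH]; apply: KM.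
have xW : \forall z \near one, W^° (x ** z).
  have := @continuous_lmul _ _ _ _ HG x one; rewrite /continuous_at (grp1r HG).
  by move=> /(_ _ (nbhs_interior Wx)).
(* Only exponents from [1] to [k] are at stake, so finitely many neighbourhoods are intersected. *)
have split_near : \forall z \near one, forall n, n \in iota 1 k -> forall t,
    t ** gpow x n = gpow x n ** t -> t ** gpow z n <> gpow z n ** t ->
    has_conjugates (gpow x n ** gpow z n) (k - n).+1.
  apply: near_seq => n; rewrite mem_iota => /andP[n0 _].
  have := @continuous_gpow _ _ _ _ HG n one.
  have e1 : gpow one n = one by elim: n {n0} => [//|n IH]; rewrite gpowS IH (grp1l HG).
  rewrite /continuous_at e1 => /(_ _ (has_conjugates_split HG _)).
  by apply; apply: WP => //; exact: nbhs_singleton Wx.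
have [j j0 Fz0] := Kfc Kz0.
have [i i0 [[Wz Tz] zP]] := gpow_recurs HG (gpow z0 j) (filterI (filterI xW T1) split_near).
set z := gpow (gpow z0 j) i in Wz Tz zP.
have zx : z ** x = x ** z := TC _ Tz.
have Kxz : K (x ** z) by apply: KM => //; do 2!apply: (Kpow).
have many n : (0 < n)%N -> has_conjugates (gpow (x ** z) n) (k.+1 - n).
  move=> n0; have [nk|kn] := leqP n k; last first.
    by exists [::]; split=> //; move: kn; rewrite -subn_eq0 => /eqP ->.
  rewrite (gpowMn HG)// subSn//.
  have jin : (0 < j * i * n)%N by rewrite !muln_gt0 j0 i0 n0.
  have [t Tt tz] := z0P _ jin.
  apply: (zP n _ t); first by rewrite mem_iota n0 add1n ltnS.
    by apply/esym/(gpow_comm HG)/esym/TC.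
  by move: tz; rewrite !(gpowM HG).
have near_many : \forall y \near x ** z, forall n, n \in iota 1 k ->
    has_conjugates (gpow y n) (k.+1 - n).
  apply: near_seq => n; rewrite mem_iota => /andP[n0 _].
  exact: (@continuous_gpow _ _ _ _ HG n (x ** z) _ (near_has_conjugates HG (many n n0))).
(* Regularity gives [W0] whose closure lies inside [W] and inside the neighbourhood of [x ** z]
   where the counts persist. *)
have [W0 W0xz W0W] := compact_regular (grp_hausdorff HG) (grp_compact HG) filterT
  (filterI near_many Wz).
exists (x ** z, closure W0); split=> /=; last first.
  by move=> y /W0W[].
split=> //=.
- apply: filterS (commutantM HG (y := z)) (filterI Fx _).
  by apply: filterS Fz0; exact: (commutant_gpow HG).
- by apply: filterS W0xz; exact: subset_closure.
- exact: closed_closure.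
move=> y /W0W[yP _] n n0; have [nk|kn] := leqP n k.
  by apply: yP; rewrite mem_iota n0 add1n ltnS.
by exists [::]; split=> //; move: kn; rewrite -subn_eq0 => /eqP ->.
Qed.

(** The products have a cluster point [y], which lies in [K] and in every closed set [(F k).2]. Some
    [gpow y n] has an open centralizer, hence at most [N] conjugates, while stage [n + N.+1]
    provides [N.+1] of them. *)
Lemma no_uniform_centralizer_absurd : False.
Proof.
case: HK => -[K1 KM KV] cK.
have /choice[next nextP] : forall kp : nat * (G * set G), exists q,
    stage kp.1 kp.2 -> stage kp.1.+1 q /\ q.2 `<=` kp.2.2.
  move=> [k p]; have [sp|nsp] := pselect (stage k p); last by exists p.
  by have [q ?] := stageS sp; exists q.
pose F := fix F k := if k is m.+1 then next (m, F m) else (one, setT).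
have FP k : stage k (F k).
  by elim: k => [|k IH]; [exact: stage0|case: (nextP (k, F k) IH)].
have Fsub k l : (k <= l)%N -> (F l).2 `<=` (F k).2.
  elim: l => [|l IH]; first by rewrite leqn0 => /eqP->.
  rewrite leq_eqVlt => /orP[/eqP->//|/IH]; apply: subset_trans.
  by case: (nextP (l, F l) (FP l)).
have [y [_ yF]] := @grp_compact _ _ _ _ HG ((fun k => (F k).1) @ \oo) _ filterT.
have yP (A : set G) N : closed A -> (forall k, (N <= k)%N -> A (F k).1) -> A y.
  move=> cA AP; by apply: cA => B yB; apply: yF (yB); exists N.
have Ky : K y by apply: (yP _ 0%N) => // k _; case: (FP k).
have [n n0 /(conjugates_finite HG)[N NP]] := Kfc Ky.
have yW : (F (n + N.+1)%N).2 y.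
  apply: (yP _ (n + N.+1)%N) => [|k nk]; first by case: (FP (n + N.+1)%N).
  by apply: (Fsub _ _ nk); case: (FP k) => _ _ /nbhs_singleton.
have [_ _ _ _ /(_ _ yW n n0)] := FP (n + N.+1)%N.
by rewrite addKn => /NP; rewrite ltnn.
Qed.
End UniformCentralizer.

Theorem uniform_centralizer (G : topologicalType) (mul : G -> G -> G) (inv : G -> G)
    (one : G) (K : set G) :
  compact_group mul inv one -> closed_subgroup mul inv one K ->
  (forall x, K x -> exists2 n, (0 < n)%N & nbhs one (commutant mul (gpow mul one x n))) ->
  exists T : set G, [/\ open T, normal_subgroup mul inv one T &
    quotient_torsion mul one K (centralizer_in mul K T)].
Proof.
move=> HG HK Kfc; apply: contrapT => nex.
apply: (no_uniform_centralizer_absurd HG HK Kfc) => T oT nT.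
apply: contrapT => noz; apply: nex; exists T; split=> // k Kk.
apply: contrapT => nok; apply: noz; exists k => // n n0.
apply: contrapT => not; apply: nok; exists n; split=> //; split.
  by case: HK => -[K1 KM _] _; elim: n {n0 not} => [//|n IH]; exact: KM.
move=> t Tt; apply: contrapT => kt; apply: not; exists t => // e.
exact/kt/esym.
Qed.

(** * From contents to measures *)

Section ContentMeasure.
Context (R : realType) (X : topologicalType) (lam : set X -> R).
Hypotheses (compactX : compact [set: X]) (hausdorffX : hausdorff_space X).
Hypotheses (lam_set0 : lam set0 = 0)
  (lam_mono : forall A B, A `<=` B -> lam A <= lam B)
  (lam_setU : forall A B, lam (A `|` B) <= lam A + lam B)
  (lam_disjoint : forall A B, closed A -> closed B -> A `&` B = set0 ->
     lam A + lam B <= lam (A `|` B)).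

Local Open Scope ereal_scope.

(** Inner content of an open set. The space is compact, so closed sets stand for compact ones, and
    only the values of [lam] on them enter. *)
Definition open_content (U : set X) : \bar R :=
  ereal_sup [set (lam K)%:E | K in [set K | closed K /\ K `<=` U]].

Definition outer_content (A : set X) : \bar R :=
  ereal_inf [set open_content U | U in [set U | open U /\ A `<=` U]].

Lemma open_content_ge K U : closed K -> K `<=` U -> (lam K)%:E <= open_content U.
Proof. by move=> cK KU; apply: ereal_sup_ubound; exists K. Qed.

Lemma open_content_mono U V : U `<=` V -> open_content U <= open_content V.
Proof.
move=> UV; apply: ereal_sup_le => _ [K [cK KU] <-].
by exists K => //; split=> //; exact: subset_trans UV.
Qed.

Lemma open_content_ge0 U : 0 <= open_content U.
Proof. by have := open_content_ge closed0 (@sub0set _ U); rewrite lam_set0. Qed.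

Lemma open_content_le U : open_content U <= (lam setT)%:E.
Proof. by apply: ge_ereal_sup => _ [K _ <-]; rewrite lee_fin; exact: lam_mono. Qed.

Lemma outer_content_le A U : open U -> A `<=` U -> outer_content A <= open_content U.
Proof. by move=> oU AU; apply: ereal_inf_lbound; exists U. Qed.

Lemma outer_content_open U : open U -> outer_content U = open_content U.
Proof.
move=> oU; apply/eqP; rewrite eq_le outer_content_le//=.
by apply: le_ereal_inf_tmp => _ [V [oV UV] <-]; exact: open_content_mono.
Qed.

Lemma outer_content_ge K : closed K -> (lam K)%:E <= outer_content K.
Proof.
by move=> cK; apply: le_ereal_inf_tmp => _ [V [oV UV] <-]; exact: open_content_ge.
Qed.

Lemma outer_content_ge0 A : 0 <= outer_content A.
Proof. by apply: le_ereal_inf_tmp => _ [V _ <-]; exact: open_content_ge0. Qed.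

Lemma outer_content_mono : {homo outer_content : A B / A `<=` B >-> A <= B}.
Proof.
move=> A B AB; apply: ereal_inf_le_tmp => _ [V [oV BV] <-].
by exists V => //; split=> //; exact: subset_trans BV.
Qed.

Lemma outer_content_fin A : outer_content A \is a fin_num.
Proof.
rewrite ge0_fin_numE ?outer_content_ge0//.
apply: le_lt_trans (ltry (lam setT)).
by apply: le_trans (open_content_le setT); exact: outer_content_le openT _.
Qed.

Lemma open_content_fin U : open_content U \is a fin_num.
Proof.
rewrite ge0_fin_numE ?open_content_ge0//.
exact: le_lt_trans (open_content_le _) (ltry _).
Qed.

Lemma outer_content0 : outer_content set0 = 0.
Proof.
rewrite outer_content_open; last exact: open0.
apply/eqP; rewrite eq_le open_content_ge0 andbT.
by apply: ge_ereal_sup => _ [K [_ K0] <-]; move: K0; rewrite subset0 => ->; rewrite lam_set0.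
Qed.

(** By normality, the part of [K] outside [V] has a neighbourhood with closure in [U]. That closure
    is one piece; the other is [K] minus an open set inside the neighbourhood. *)
Lemma closed_split (K U V : set X) : closed K -> open U -> open V -> K `<=` U `|` V ->
  exists K1 K2 : set X, [/\ closed K1, closed K2, K1 `<=` U, K2 `<=` V & K `<=` K1 `|` K2].
Proof.
move=> cK oU oV KUV.
have cKV : closed (K `&` ~` V) by apply: closedI => //; exact: open_closedC.
have KVU : set_nbhs (K `&` ~` V) U.
  apply/set_nbhsP; exists U; split=> // x [Kx nVx]; by case: (KUV x Kx).
have [W /set_nbhsP[C [oC KC CW]] cWU] := compact_normal hausdorffX compactX cKV KVU.
exists (closure W), (K `&` ~` C); split=> //.
- exact: closed_closure.
- by apply: closedI => //; exact: open_closedC.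
- by move=> x [Kx nCx]; apply: contrapT => nVx; apply/nCx/KC.
move=> x Kx; have [Cx|nCx] := pselect (C x); last by right.
by left; exact/subset_closure/CW.
Qed.

Lemma content_finite_cover (U : nat -> set X) n K : (forall i, open (U i)) ->
  closed K -> K `<=` \big[setU/set0]_(i < n) U i ->
  (lam K)%:E <= \sum_(i < n) open_content (U i).
Proof.
move=> oU; elim: n K => [|n IH] K cK.
  by rewrite !big_ord0 subset0 => ->; rewrite lam_set0.
rewrite !big_ord_recr /= => KU.
have oV : open (\big[setU/set0]_(i < n) U i).
  by rewrite -bigcup_mkord; apply: bigcup_open => i _; exact: oU.
have [K1 [K2 [cK1 cK2 K1U K2V K12]]] := closed_split cK oV (oU n) KU.
apply: (@le_trans _ _ ((lam K1)%:E + (lam K2)%:E)).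
  by rewrite -EFinD lee_fin; exact: le_trans (lam_mono K12) (lam_setU _ _).
by apply: leeD; [exact: IH|exact: open_content_ge].
Qed.

(** A closed set inside the union is compact, hence already inside finitely many [U i], where
    [content_finite_cover] applies. *)
Lemma open_content_bigcup (U : nat -> set X) : (forall i, open (U i)) ->
  open_content (\bigcup_i U i) <= \sum_(i <oo) open_content (U i).
Proof.
move=> oU; apply: ge_ereal_sup => _ [K [cK KU] <-].
have cptK : compact K by exact: subclosed_compact cK compactX _.
have /compact_near_coveringP := cptK.
move=> /(_ _ \oo (fun n x => (\big[setU/set0]_(i < n) U i) x)) [] //.
  move=> x /KU[i _ Uix]; exists (U i, [set n | (i < n)%N]) => /=.
    split; first exact: open_nbhs_nbhs.
    by exists i.+1.
  move=> [y n] /= [Uiy iln]; rewrite -bigcup_mkord.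
  by exists i.
move=> N _ /(_ N (leqnn N)) KN.
apply: le_trans (content_finite_cover oU cK KN) _.
rewrite -(big_mkord xpredT (fun i => open_content (U i))).
by apply: nneseries_lim_ge => *; exact: open_content_ge0.
Qed.

Lemma outer_content_sigma_subadditive : sigma_subadditive outer_content.
Proof.
move=> F; apply/lee_addgt0Pr => e e0.
have /choice[U UP] : forall n, exists U, [/\ open U, F n `<=` U &
    open_content U <= outer_content (F n) + (e / (2 ^ n.+1)%:R)%:E].
  move=> n; have en : (0 < e / (2 ^ n.+1)%:R)%R by rewrite divr_gt0// ltr0n expn_gt0.
  have [_ [U [oU FU] <-] /ltW h] := lb_ereal_inf_adherent en (outer_content_fin (F n)).
  by exists U.
apply: (@le_trans _ _ (\sum_(i <oo) open_content (U i))).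
  apply: le_trans (open_content_bigcup _); last by move=> i; case: (UP i).
  apply: outer_content_le; first by apply: bigcup_open => i _; case: (UP i).
  by move=> x [i _ Fx]; exists i => //; case: (UP i) => _ + _; apply.
apply: le_trans (epsilon_trick xpredT _ (ltW e0)); last by move=> n; exact: outer_content_ge0.
apply: lee_nneseries => [i _ _|i _]; first exact: open_content_ge0.
by case: (UP i).
Qed.

Definition content_outer_measure : {outer_measure set X -> \bar R} :=
  HB.pack outer_content (isOuterMeasure.Build R X outer_content outer_content0
    outer_content_ge0 outer_content_mono outer_content_sigma_subadditive).

(** Caratheodory's inequality for an open test set. Take [K] closed in [V] and [U], then [L] closed
    in [V] outside [K]: superadditivity of [lam] on this disjoint pair, followed by two suprema,
    gives the bound. *)
Lemma open_content_additive U V : open U -> open V ->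
  outer_content (V `&` U) + outer_content (V `&` ~` U) <= open_content V.
Proof.
move=> oU oV; rewrite (outer_content_open (openI oV oU)).
rewrite -leeBrDr ?outer_content_fin//.
apply: ge_ereal_sup => _ [K [cK KVU] <-].
rewrite leeBrDr ?outer_content_fin//.
have oVK : open (V `&` ~` K) by apply: openI => //; exact: closed_openC.
have : outer_content (V `&` ~` U) <= open_content (V `&` ~` K).
  by apply: outer_content_le => // x [Vx nUx]; split=> // /KVU[].
move=> /(leeD2l (lam K)%:E) /le_trans; apply.
rewrite addeC -leeBrDr//.
apply: ge_ereal_sup => _ [L [cL LVK] <-].
rewrite leeBrDr// -EFinD addrC.
apply: (@le_trans _ _ (lam (K `|` L))%:E).
  rewrite lee_fin; apply: lam_disjoint => //.
  by rewrite -subset0 => x [Kx /LVK[]].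
apply: open_content_ge; first exact: closedU.
by move=> x [/KVU[]|/LVK[]].
Qed.

(** Caratheodory-measurable sets form a sigma-algebra, so open sets suffice; for them an arbitrary
    test set is replaced by the open sets containing it. *)
Lemma caratheodory_borel A : borel A -> content_outer_measure.-caratheodory A.
Proof.
apply: smallest_sub => [|U oU].
  split=> [|B|F]; first exact: caratheodory_measurable_set0.
    by rewrite setTD; exact: caratheodory_measurable_setC.
  exact: caratheodory_measurable_bigcup.
apply: le_caratheodory_measurable => Y /=.
apply: le_ereal_inf_tmp => _ [V [oV YV] <-].
apply: le_trans (open_content_additive oU oV).
by apply: leeD; apply: outer_content_mono; exact: setSI.
Qed.

Local Close Scope ereal_scope.

Definition content_measure (A : set X) : R := fine (outer_content A).

Lemma content_measureE A : (content_measure A)%:E = outer_content A.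
Proof. exact/fineK/outer_content_fin. Qed.

Lemma content_measure_ge0 A : 0 <= content_measure A.
Proof. by rewrite -lee_fin content_measureE outer_content_ge0. Qed.

Lemma content_measure_ge K : closed K -> lam K <= content_measure K.
Proof. by move=> cK; rewrite -lee_fin content_measureE outer_content_ge. Qed.

Lemma content_measure_leT A : content_measure A <= lam setT.
Proof.
rewrite -lee_fin content_measureE; apply: le_trans (open_content_le setT).
exact: outer_content_le openT _.
Qed.

Lemma content_measure_sigma_additive (F : nat -> set X) :
  (forall n, borel (F n)) -> trivIset setT F ->
  (fun n => \sum_(0 <= i < n) content_measure (F i)) @ \oo -->
    (content_measure (\bigcup_n F n) : R^o).
Proof.
move=> bF tF.
have cF n := caratheodory_borel (bF n).
have sumE : (\sum_(i <oo) outer_content (F i) = outer_content (\bigcup_n F n))%E.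
  apply/eqP; rewrite eq_le outer_content_sigma_subadditive andbT.
  (* The test set is the union itself, so the term for the complement vanishes. *)
  have := caratheodory_lime_le cF tF (\bigcup_n F n).
  rewrite setICr /= outer_content0 adde0; apply: le_trans.
  apply: lee_nneseries => [i _ _|i _]; first exact: outer_content_ge0.
  rewrite (_ : _ `&` _ = F i)//; apply/seteqP; split=> [x []//|x Fx].
  by split=> //; exists i.
have cvgE : (fun n => \sum_(0 <= i < n) outer_content (F i))%E @ \oo -->
    (content_measure (\bigcup_n F n))%:E.
  rewrite content_measureE -sumE; apply: is_cvg_nneseries => i _ _.
  exact: outer_content_ge0.
apply: cvg_trans (fine_cvg cvgE); apply: near_eq_cvg; apply: nearW => n /=.
by under eq_bigr do rewrite -content_measureE; rewrite sumEFin.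
Qed.

Lemma content_measure_outer_regular A (e : R) : 0 < e ->
  exists U, [/\ open U, A `<=` U & content_measure U <= content_measure A + e].
Proof.
move=> e0; have [_ [U [oU AU] <-] /ltW h] := lb_ereal_inf_adherent e0 (outer_content_fin A).
exists U; split=> //.
by rewrite -lee_fin EFinD !content_measureE outer_content_open.
Qed.

(** A closed [K] with [lam K] within [e] of the supremum works, since the measure of [K] is at least
    [lam K]. *)
Lemma content_measure_inner_regular U (e : R) : open U -> 0 < e ->
  exists K, [/\ compact K, K `<=` U & content_measure U <= content_measure K + e].
Proof.
move=> oU e0; have [_ [K [cK KU] <-] h] := ub_ereal_sup_adherent e0 (open_content_fin U).
exists K; split=> //; first exact: subclosed_compact cK compactX _.
rewrite -lee_fin EFinD !content_measureE outer_content_open//.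
rewrite -leeBlDr//; apply: le_trans (outer_content_ge cK); exact: ltW.
Qed.

(** A homeomorphism permutes the closed sets and the open sets, so the supremum and the infimum run
    over the same values. *)
Lemma content_measure_invariant (f g : X -> X) :
  cancel f g -> cancel g f -> continuous f -> continuous g ->
  (forall A, lam (f @` A) = lam A) ->
  forall A, content_measure (f @` A) = content_measure A.
Proof.
move=> fK gK cf cg lamf.
have imf A : f @` A = g @^-1` A.
  apply/seteqP; split=> [_ [x Ax <-]|x Ax] /=; first by rewrite fK.
  by exists (g x).
have img A : g @` A = f @^-1` A.
  apply/seteqP; split=> [_ [x Ax <-]|x Ax] /=; first by rewrite gK.
  by exists (f x).
have fgK A : f @` (g @` A) = A.
  by rewrite img imf; apply/seteqP; split=> x /=; rewrite gK.
have ocf U : open_content (f @` U) = open_content U.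
  congr ereal_sup; apply/seteqP; split=> _ [K [cK KU] <-].
    exists (g @` K).
      split; first by rewrite img; apply: closed_comp => // ? _; exact: cf.
      by move=> _ [x /KU[y Uy <-] <-]; rewrite fK.
    by rewrite -lamf fgK.
  exists (f @` K); last by rewrite lamf.
  split; first by rewrite imf; apply: closed_comp => // ? _; exact: cg.
  exact: image_subset.
move=> A; congr (fine (ereal_inf _)); apply/seteqP; split=> _ [U [oU AU] <-].
  exists (g @` U).
    split; first by rewrite img; apply: open_comp => // ? _; exact: cf.
    by move=> x Ax; rewrite img /=; apply: AU; exists x.
  by rewrite -ocf fgK.
exists (f @` U); last by rewrite ocf.
split; first by rewrite imf; apply: open_comp => // ? _; exact: cg.
exact: image_subset.
Qed.

End ContentMeasure.

(** * Existence of the Haar measure *)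

(** Compactness of the segment yields a cluster point, which for an ultrafilter is a limit. *)
Lemma ultra_cvg_segment (R : realType) (T : Type) (F : set_system T) (f : T -> R) a b :
  UltraFilter F -> (\forall x \near F, a <= f x <= b) -> cvg (f @ F).
Proof.
move=> UF fab.
have [|p [_ pF]] := @segment_compact R a b (f @ F) _.
  by apply: filterS fab => x; rewrite /= in_itv.
apply/cvg_ex; exists p => V pV.
have [//|nV] := @in_ultra_setVsetC _ _ (f @^-1` V) UF.
by have [y []] := pF (~` V) V nV pV.
Qed.

Lemma le_lim_filter (R : realType) (T : Type) (F : set_system T) (f g : T -> R) :
  ProperFilter F -> cvg (f @ F) -> cvg (g @ F) -> (\forall x \near F, f x <= g x) ->
  lim (f @ F) <= lim (g @ F).
Proof.
move=> FF cf cg fg; rewrite -subr_ge0 -(limB cg cf); apply: limr_ge.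
  exact: is_cvgB.
by apply: filterS fg => x; rewrite subr_ge0.
Qed.

Section HaarContent.
Context (R : realType) (G : topologicalType).
Context (mul : G -> G -> G) (inv : G -> G) (one : G).
Hypothesis HG : compact_group mul inv one.
Context (H : set G).
Hypothesis HH : closed_subgroup mul inv one H.

Local Notation "x ** y" := (mul x y) (at level 40, left associativity).

(** Centres and covered points are both restricted to [H]: this is Haar's covering of the trace of
    [A] on [H], while [A] and [U] remain subsets of [G]. The resulting content lives on [G] and is
    concentrated on [H]. *)
Definition covers (A U : set G) (s : seq G) : Prop :=
  (forall a, a \in s -> H a) /\
  forall g, A g -> H g -> exists2 a, a \in s & U (inv a ** g).

Definition is_covering_number (A U : set G) (n : nat) : Prop :=
  (exists2 s, size s = n & covers A U s) /\ forall s, covers A U s -> (n <= size s)%N.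

Definition covering_number (A U : set G) : nat := xget 0%N (is_covering_number A U).

Lemma covering_numberP A U : nbhs one U -> is_covering_number A U (covering_number A U).
Proof.
move=> U1; apply: xgetPex.
have [s sH sP] := finite_translate_cover HG H U1.
have ex : exists n, `[< exists2 s, size s = n & covers A U s >].
  by exists (size s); apply/asboolP; exists s => //; split=> // g _; exact: sP.
case: (ex_minnP ex) => n /asboolP nP nmin; exists n; split=> // s' s'c.
by apply: nmin; apply/asboolP; exists s'.
Qed.

Lemma covering_number_le A U s : nbhs one U -> covers A U s ->
  (covering_number A U <= size s)%N.
Proof. by move=> /(covering_numberP A)[_ +]; apply. Qed.

Lemma covering_number_mono A B U : nbhs one U -> A `&` H `<=` B ->
  (covering_number A U <= covering_number B U)%N.
Proof.
move=> U1 AB; have [[s <- [sH sP]] _] := covering_numberP B U1.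
by apply: covering_number_le => //; split=> // g Ag Hg; apply: sP => //; exact: AB.
Qed.

Lemma covering_number_set0 U : nbhs one U -> covering_number set0 U = 0%N.
Proof.
by move=> U1; apply/eqP; rewrite -leqn0; apply: (@covering_number_le _ _ [::]).
Qed.

Lemma covering_number_setU A B U : nbhs one U ->
  (covering_number (A `|` B) U <= covering_number A U + covering_number B U)%N.
Proof.
move=> U1; have [[s <- [sH sP]] _] := covering_numberP A U1.
have [[t <- [tH tP]] _] := covering_numberP B U1.
rewrite -size_cat; apply: covering_number_le => //; split=> [a|g [Ag|Bg] Hg].
- by rewrite mem_cat => /orP[/sH|/tH].
- by have [a sa] := sP g Ag Hg; exists a => //; rewrite mem_cat sa.
- by have [a sa] := tP g Bg Hg; exists a => //; rewrite mem_cat sa orbT.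
Qed.

Lemma covering_number_gt0 U : nbhs one U -> (0 < covering_number setT U)%N.
Proof.
move=> U1; have [[s sz [sH sP]] _] := covering_numberP setT U1.
case: HH => -[H1 _ _] _.
have [a + _] := sP one Logic.I H1.
by rewrite -sz; case: s {sz sH sP}.
Qed.

Lemma covering_number_lmul_le A U h : nbhs one U -> H h ->
  (covering_number [set h ** a | a in A] U <= covering_number A U)%N.
Proof.
case: HH => -[H1 HM HV] _ U1 Hh.
have [[s <- [sH sP]] _] := covering_numberP A U1.
rewrite -(size_map (mul h) s); apply: covering_number_le => //.
split=> [_ /mapP[a /sH Ha ->]|_ [g Ag <-] Hhg]; first exact: HM.
have [|a sa Ua] := sP g Ag.
  by rewrite -(grpK HG h g); apply: HM => //; exact: HV.
exists (h ** a); first exact: map_f.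
by rewrite (grp_invM HG) -(grpA HG) (grpK HG).
Qed.

Lemma covering_number_lmul A U h : nbhs one U -> H h ->
  covering_number [set h ** a | a in A] U = covering_number A U.
Proof.
move=> U1 Hh; apply/eqP; rewrite eqn_leq covering_number_lmul_le//=.
have Hh' : H (inv h) by case: HH => -[_ _ HV] _; exact: HV.
have := covering_number_lmul_le [set h ** a | a in A] U1 Hh'.
rewrite image_comp (_ : [set _ | _ in A] = A)//.
apply/seteqP; split=> [_ [a Aa <-] /=|a Aa]; first by rewrite (grpK HG).
by exists a => //=; rewrite (grpK HG).
Qed.

(** By the tube lemma, no translate of a small [U] meets both [A] and [B]. The centres of an optimal
    cover of the union then split into those whose translate meets [A] and the others, which cover
    the points of [B]. *)
Lemma covering_number_disjoint A B : closed A -> closed B -> A `&` B = set0 ->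
  \forall U \near powerset_filter_from (nbhs one), nbhs one U ->
    (covering_number A U + covering_number B U <= covering_number (A `|` B) U)%N.
Proof.
move=> cA cB AB0.
pose bad U g := exists u v, [/\ U u, U v, A (g ** u) & B (g ** v)].
have small (C : set G) g : closed C -> ~ C g ->
    \forall h \near g & U \near powerset_filter_from (nbhs one), forall u, U u -> ~ C (h ** u).
  move=> cC nC.
  have := @grp_mul_continuous _ _ _ _ HG (g, one); rewrite /continuous_at /= (grp1r HG).
  move=> /(_ _ (open_nbhs_nbhs (conj (closed_openC cC) nC)))[[V W] /= [gV W1] VW].
  exists (V, [set U | U `<=` W]) => /=; first by split=> //; exact: small_set_sub.
  by move=> [h U] /= [Vh UW] u /UW Wu; exact: (VW (h, u)).
have : \forall U \near powerset_filter_from (nbhs one), forall g, ~ bad U g.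
  apply: (tube HG) => g.
  have [Ag|nAg] := pselect (A g); last first.
    apply: filterS (small A g cA nAg) => -[h U] /= hU [u [v [Uu _ Au _]]].
    exact: hU Uu Au.
  have nBg : ~ B g by move=> Bg; have : (A `&` B) g by []; rewrite AB0.
  apply: filterS (small B g cB nBg) => -[h U] /= hU [u [v [_ Uv _ Bv]]].
  exact: hU Uv Bv.
apply: filterS => U good U1.
have [[s <- [sH sP]] _] := covering_numberP (A `|` B) U1.
pose p a := `[< exists2 g, A g & U (inv a ** g) >].
rewrite -(count_predC p s) -!size_filter; apply: leq_add; apply: covering_number_le => //.
  split=> [a|g Ag Hg]; first by rewrite mem_filter => /andP[_ /sH].
  have [a sa Ua] := sP g (or_introl Ag) Hg; exists a => //.
  by rewrite mem_filter sa andbT; apply/asboolP; exists g.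
split=> [a|g Bg Hg]; first by rewrite mem_filter => /andP[_ /sH].
have [a sa Ua] := sP g (or_intror Bg) Hg; exists a => //.
rewrite mem_filter sa andbT /=; apply/asboolPn => -[g' Ag' Ua'].
by apply: (good a); exists (inv a ** g'), (inv a ** g); rewrite !(grpVK HG).
Qed.

Lemma covering_number_invr_gt0 U : nbhs one U ->
  0 < (covering_number setT U)%:R^-1 :> R.
Proof. by move=> U1; rewrite invr_gt0 ltr0n covering_number_gt0. Qed.

Definition covering_ratio (A U : set G) : R :=
  (covering_number A U)%:R / (covering_number setT U)%:R.

Context (F : set_system (set G)).
Hypotheses (UF : UltraFilter F) (Fsmall : powerset_filter_from (nbhs one) `<=` F).

(** Along an ultrafilter the ratios of all sets [A] converge simultaneously, so inequalities between
    them pass to the limit. *)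
Definition haar_content (A : set G) : R := lim (covering_ratio A @ F).

Let F1 : \forall U \near F, nbhs one U.
Proof. exact/Fsmall/near_small_set. Qed.

Lemma covering_ratio_cvg A : cvg (covering_ratio A @ F).
Proof.
apply: (@ultra_cvg_segment _ _ _ _ 0 1); apply: filterS F1 => U U1.
rewrite divr_ge0//= ler_pdivrMr ?ltr0n ?covering_number_gt0// mul1r ler_nat.
exact: covering_number_mono.
Qed.

Lemma haar_content_set0 : haar_content set0 = 0.
Proof.
apply: lim_near_cst => //; apply: filterS F1 => U U1.
by rewrite /covering_ratio covering_number_set0// mul0r.
Qed.

Lemma haar_contentT : haar_content setT = 1.
Proof.
apply: lim_near_cst => //; apply: filterS F1 => U U1.
by rewrite /covering_ratio divff// pnatr_eq0 -lt0n covering_number_gt0.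
Qed.

Lemma haar_content_le A B : A `&` H `<=` B -> haar_content A <= haar_content B.
Proof.
move=> AB; apply: le_lim_filter; try exact: covering_ratio_cvg.
apply: filterS F1 => U U1; rewrite ler_pM2r ?covering_number_invr_gt0//.
by rewrite ler_nat covering_number_mono.
Qed.

Lemma haar_content_setU A B : haar_content (A `|` B) <= haar_content A + haar_content B.
Proof.
rewrite -(limD (@covering_ratio_cvg A) (@covering_ratio_cvg B)).
apply: le_lim_filter; first exact: covering_ratio_cvg.
  by apply: is_cvgD; exact: covering_ratio_cvg.
apply: filterS F1 => U U1.
have : (covering_number (A `|` B) U)%:R <= (covering_number A U)%:R + (covering_number B U)%:R :> R.
  by rewrite -natrD ler_nat covering_number_setU.
by rewrite -(ler_pM2r (covering_number_invr_gt0 U1)) mulrDl.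
Qed.

Lemma haar_content_disjoint A B : closed A -> closed B -> A `&` B = set0 ->
  haar_content A + haar_content B <= haar_content (A `|` B).
Proof.
move=> cA cB AB0; rewrite -(limD (@covering_ratio_cvg A) (@covering_ratio_cvg B)).
apply: le_lim_filter; last 1 first.
- have := Fsmall (covering_number_disjoint cA cB AB0).
  move=> disj; apply: (filterS2 _ _ F1 disj) => U U1 /(_ U1).
  rewrite -(ler_nat R) natrD.
  by rewrite -(ler_pM2r (covering_number_invr_gt0 U1)) mulrDl.
- by apply: is_cvgD; exact: covering_ratio_cvg.
- exact: covering_ratio_cvg.
Qed.

Lemma haar_content_lmul h A : H h -> haar_content [set h ** a | a in A] = haar_content A.
Proof.
move=> Hh; apply/eqP; rewrite eq_le; apply/andP; split; apply: le_lim_filter;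
  try exact: covering_ratio_cvg;
  by apply: filterS F1 => U U1; rewrite /covering_ratio covering_number_lmul.
Qed.

End HaarContent.

Theorem haar_measure_exists (R : realType) (G : topologicalType)
    (mul : G -> G -> G) (inv : G -> G) (one : G) (H : set G) :
  compact_group mul inv one -> closed_subgroup mul inv one H ->
  exists mu : set G -> R, haar_measure mul H mu.
Proof.
move=> HG HH.
have [F [UF Fsmall]] := ultraFilterLemma (powerset_filter_from_filter (nbhs_pfilter one)).
pose lam := @haar_content R G mul inv H F.
have cG := grp_compact HG; have hG := grp_hausdorff HG.
have lam0 : lam set0 = 0 by exact: (haar_content_set0 R HG H UF Fsmall).
have lam_mono A B : A `<=` B -> lam A <= lam B.
  by move=> AB; apply: (haar_content_le R HG HH UF Fsmall) => // x [/AB].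
have lamU A B : lam (A `|` B) <= lam A + lam B by exact: (haar_content_setU R HG HH UF Fsmall).
have lamD A B : closed A -> closed B -> A `&` B = set0 -> lam A + lam B <= lam (A `|` B).
  exact: (haar_content_disjoint R HG HH UF Fsmall).
have lamT : lam setT = 1 by exact: (haar_contentT R HG HH UF Fsmall).
(* The content sees only traces on [H], so [H] weighs as much as the whole space. *)
have lamH : lam H = 1.
  apply/eqP; rewrite eq_le -{1}lamT lam_mono//= -lamT.
  by apply: (haar_content_le R HG HH UF Fsmall) => // x [].
have le1 A : content_measure lam A <= 1 by rewrite -lamT; exact: content_measure_leT.
exists (content_measure lam); do 6?split.
- by move=> A _; exact: content_measure_ge0.
- exact: content_measure_sigma_additive.
- by apply/eqP; rewrite eq_le le1 -lamT content_measure_ge//; exact: closedT.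
- by apply/eqP; rewrite eq_le le1 -lamH content_measure_ge//; case: HH.
- move=> h A Hh _; apply: (@content_measure_invariant _ _ _ _ (mul (inv h))).
  + exact: (grpK HG).
  + exact: (grpVK HG).
  + exact: (continuous_lmul HG).
  + exact: (continuous_lmul HG).
  + by move=> B; exact: (haar_content_lmul R HG HH UF Fsmall).
- by move=> A _ e e0; exact: content_measure_outer_regular.
- by move=> U oU e e0; exact: content_measure_inner_regular.
Qed.

(** * Null sets of Haar measures *)

Section Borel.
Context (X : topologicalType).
Implicit Types A B : set X.

Lemma borel_open A : open A -> borel A.
Proof. exact: sub_sigma_algebra. Qed.

Lemma borel0 : borel (set0 : set X).
Proof. exact: sigma_algebra0. Qed.

Lemma borelC A : borel A -> borel (~` A).
Proof. by move=> bA; rewrite -setTD; exact: sigma_algebraCD. Qed.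

Lemma borel_closed A : closed A -> borel A.
Proof.
by move=> cA; rewrite -[A]setCK; apply: borelC; apply: borel_open; exact: closed_openC.
Qed.

Lemma borel_bigcup (F : nat -> set X) : (forall n, borel (F n)) -> borel (\bigcup_n F n).
Proof. exact: sigma_algebra_bigcup. Qed.

Lemma borel_bigcup2 A B : borel A -> borel B -> forall n, borel (bigcup2 A B n).
Proof. by move=> bA bB [|[|n]] //=; exact: borel0. Qed.

Lemma borelU A B : borel A -> borel B -> borel (A `|` B).
Proof. by move=> bA bB; rewrite -bigcup2E; apply: borel_bigcup; exact: borel_bigcup2. Qed.

Lemma borelI A B : borel A -> borel B -> borel (A `&` B).
Proof.
move=> bA bB; rewrite -[_ `&` _]setCK setCI.
by apply: borelC; apply: borelU; exact: borelC.
Qed.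

Lemma borelD A B : borel A -> borel B -> borel (A `\` B).
Proof. by move=> bA bB; rewrite setDE; apply: borelI => //; exact: borelC. Qed.

Lemma borel_bigsetU (F : nat -> set X) n : (forall i, borel (F i)) ->
  borel (\big[setU/set0]_(i < n) F i).
Proof.
move=> bF; elim: n => [|n IH]; first by rewrite big_ord0; exact: borel0.
by rewrite big_ord_recr /=; exact: borelU.
Qed.

Context (R : realType) (m : set X -> R).
Hypotheses (m_ge0 : forall A, borel A -> 0 <= m A)
  (m_sigma : forall F : nat -> set X, (forall n, borel (F n)) -> trivIset setT F ->
     (fun n => \sum_(0 <= i < n) m (F i) : R) @ \oo --> (m (\bigcup_n F n) : R^o)).

(** The series with constant term [m set0] converges, so its term tends to [0]. *)
Lemma bmeasure0 : m set0 = 0.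
Proof.
have tF : trivIset setT (fun _ : nat => set0 : set X) by move=> i j _ _ [x []].
have /cvgP/cvg_series_cvg_0 := m_sigma (fun _ => borel0) tF.
by move=> /cvg_lim; rewrite lim_cst => //; exact.
Qed.

Lemma bmeasureU A B : borel A -> borel B -> A `&` B = set0 -> m (A `|` B) = m A + m B.
Proof.
move=> bA bB AB0.
have tF : trivIset setT (bigcup2 A B).
  move=> [|[|i]] [|[|j]] _ _ //= [x []] //= ? ?.
    by have : (A `&` B) x by []; rewrite AB0.
  by have : (A `&` B) x by []; rewrite AB0.
have := m_sigma (borel_bigcup2 bA bB) tF; rewrite bigcup2E => cvgAB.
apply: (@cvg_unique _ (@norm_hausdorff _ R^o) _ _ _ _ cvgAB).
apply: cvg_near_cst; exists 2%N => // n /= n2.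
case: n n2 => [|[|n]]// _; rewrite !big_nat_recl//= big1 ?addr0// => i _.
exact: bmeasure0.
Qed.

Lemma bmeasure_setD A B : borel A -> borel B -> m A = m (A `&` B) + m (A `\` B).
Proof.
move=> bA bB; rewrite -bmeasureU.
- congr m; apply/seteqP; split=> [x Ax|x [[]|[]]//].
  by have [Bx|nBx] := pselect (B x); [left|right].
- exact: borelI.
- exact: borelD.
- by rewrite -subset0 => x [[_ Bx] [_]].
Qed.

Lemma bmeasure_mono A B : borel A -> borel B -> A `<=` B -> m A <= m B.
Proof.
move=> bA bB AB; rewrite (bmeasure_setD bB bA) (setIidr AB) lerDl m_ge0//.
exact: borelD.
Qed.

Lemma bmeasureUI A B : borel A -> borel B -> m (A `|` B) = m A + m B - m (A `&` B).
Proof.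
move=> bA bB; rewrite (bmeasure_setD bB bA) setIC [m A + _]addrCA.
rewrite [m (A `&` B) + _]addrC addrK -bmeasureU//.
- by congr m; apply/seteqP; split=> [x [Ax|Bx]|x [Ax|[Bx _]]];
    [left| |left|right] => //; have [Ax|nAx] := pselect (A x); [left|right].
- exact: borelD.
- by rewrite -subset0 => x [Ax [_]].
Qed.

Lemma bmeasureU_le A B : borel A -> borel B -> m (A `|` B) <= m A + m B.
Proof. by move=> bA bB; rewrite bmeasureUI// gerBl m_ge0//; exact: borelI. Qed.

Lemma bmeasure_bigcup_null (F : nat -> set X) : (forall n, borel (F n)) ->
  (forall n, m (F n) = 0) -> m (\bigcup_n F n) = 0.
Proof.
move=> bF F0; rewrite seqDU_bigcup_eq.
have bD n : borel (seqDU F n).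
  by apply: borelD => //; exact: borel_bigsetU.
have := m_sigma bD (@trivIset_seqDU _ F).
rewrite (_ : (fun n => _) = cst 0); first by move=> /cvg_lim <-//; rewrite lim_cst.
apply/funext => n; rewrite big1// => i _; apply/eqP; rewrite eq_le m_ge0// andbT.
by rewrite -(F0 i); apply: bmeasure_mono => // x [].
Qed.

Lemma bmeasure_bigsetU_null (F : nat -> set X) n : (forall i, borel (F i)) ->
  (forall i, (i < n)%N -> m (F i) = 0) -> m (\big[setU/set0]_(i < n) F i) = 0.
Proof.
move=> bF; elim: n => [|n IH] F0; first by rewrite big_ord0 bmeasure0.
have bI := borel_bigsetU n bF.
rewrite big_ord_recr /=; apply/eqP; rewrite eq_le m_ge0 ?andbT; last exact: borelU.
apply: le_trans (bmeasureU_le bI (bF n)) _.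
by rewrite F0// IH ?addr0// => i ilt; apply: F0; exact: leqW.
Qed.

End Borel.

Section HaarMeasure.
Context (G : topologicalType) (mul : G -> G -> G) (inv : G -> G) (one : G).
Hypothesis HG : compact_group mul inv one.
Context (R : realType) (H : set G) (mu : set G -> R).
Hypothesis Hmu : haar_measure mul H mu.

Local Notation "x ** y" := (mul x y) (at level 40, left associativity).

Let mu_ge0 : forall A, borel A -> 0 <= mu A. Proof. by case: Hmu. Qed.
Let mu_sigma : forall F : nat -> set G, (forall n, borel (F n)) -> trivIset setT F ->
     (fun n => \sum_(0 <= i < n) mu (F i) : R) @ \oo --> (mu (\bigcup_n F n) : R^o).
Proof. by case: Hmu => _ []. Qed.
Let muT : mu setT = 1. Proof. by case: Hmu => _ [_ []]. Qed.
Let mu_lmul h A : H h -> borel A -> mu [set h ** a | a in A] = mu A.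
Proof. by case: Hmu => _ [_ [_ [_ [+ _]]]]; apply. Qed.

(** The first [n] translates overlap in null sets, so their union has mass [n%:R * mu A], which
    stays below [1] for every [n]. *)
Lemma haar_null_translates A (f : nat -> G) : closed A -> (forall i, H (f i)) ->
  (forall i j, (i < j)%N ->
     mu ([set f i ** a | a in A] `&` [set f j ** a | a in A]) = 0) ->
  mu A = 0.
Proof.
move=> cA Hf null.
pose F i := [set f i ** a | a in A].
have bF i : borel (F i) by apply: borel_closed; exact: (closed_lmul HG).
have sumE n : mu (\big[setU/set0]_(i < n) F i) = n%:R * mu A.
  elim: n => [|n IH]; first by rewrite big_ord0 mul0r (bmeasure0 mu_sigma).
  have bn := borel_bigsetU n bF.
  rewrite big_ord_recr /= (bmeasureUI mu_sigma)// IH.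
  have bI i : borel (F i `&` F n) by exact: borelI.
  rewrite -[in X in _ - X]bigcup_mkord setI_bigcupl bigcup_mkord.
  rewrite (bmeasure_bigsetU_null mu_ge0 mu_sigma bI) ?subr0; last by move=> i; exact: null.
  by rewrite mu_lmul//; [rewrite -natr1 mulrDl mul1r|exact: borel_closed].
have bA := borel_closed cA.
apply/eqP; rewrite eq_le mu_ge0// andbT leNgt; apply/negP => A0.
have [n nA] : exists n : nat, (mu A)^-1 < n%:R.
  by exists (Num.bound (mu A)^-1); apply: archi_boundP; rewrite invr_ge0 ltW.
have : mu (\big[setU/set0]_(i < n) F i) <= 1.
  rewrite -muT; apply: (bmeasure_mono mu_ge0 mu_sigma) => //.
    exact: borel_bigsetU.
  by apply: borel_open; exact: openT.
by rewrite sumE leNgt -ltr_pdivrMr// mul1r nA.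
Qed.

(** The [f i] lie in distinct left cosets of [A], so the translates are even disjoint. *)
Lemma haar_null_subgroup A (f : nat -> G) :
  closed_subgroup mul inv one A -> (forall i, H (f i)) ->
  (forall i j, (i < j)%N -> ~ A (inv (f i) ** f j)) -> mu A = 0.
Proof.
move=> [[A1 AM AV] cA] Hf fA; apply: (@haar_null_translates _ f) => // i j ij.
rewrite (_ : _ `&` _ = set0) ?(bmeasure0 mu_sigma)// -subset0 => _ [[a Aa <-] [b Ab e]].
apply: (fA i j ij); have -> : inv (f i) ** f j = a ** inv b.
  by apply: (grpI HG (x := f i)); rewrite (grpVK HG) (grpA HG) -e (grprK HG).
by apply: AM => //; exact: AV.
Qed.

(** Invariance and countable subadditivity. It is applied below to sets [B] of mass [1], to show
    that some [A i] is not null. *)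
Lemma haar_null_cover (A : nat -> set G) (B : set G) (f : nat -> nat -> G) :
  (forall i, closed (A i)) -> borel B -> (forall i j, H (f i j)) ->
  (forall i, mu (A i) = 0) ->
  B `<=` \bigcup_i \bigcup_j [set f i j ** a | a in A i] -> mu B = 0.
Proof.
move=> cA bB Hf A0 Bsub.
have bt i j : borel [set f i j ** a | a in A i].
  by apply: borel_closed; exact: (closed_lmul HG).
have bc i : borel (\bigcup_j [set f i j ** a | a in A i]) by exact: borel_bigcup.
apply/eqP; rewrite eq_le mu_ge0// andbT.
rewrite -(_ : mu (\bigcup_i \bigcup_j [set f i j ** a | a in A i]) = 0).
  by apply: (bmeasure_mono mu_ge0 mu_sigma) => //; exact: borel_bigcup.
apply: (bmeasure_bigcup_null mu_ge0 mu_sigma) => // i.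
apply: (bmeasure_bigcup_null mu_ge0 mu_sigma) => // j.
by rewrite mu_lmul//; exact: borel_closed.
Qed.

End HaarMeasure.

(** * Commuting pairs in a monothetic subgroup *)

Lemma hausdorff_prod (X Y : topologicalType) :
  hausdorff_space X -> hausdorff_space Y -> hausdorff_space (X * Y)%type.
Proof.
move=> hX hY p q pq; rewrite [p]surjective_pairing [q]surjective_pairing.
congr (_, _).
  apply: hX => A B pA qB.
  have [z [Az Bz]] := pq (fst @^-1` A) (fst @^-1` B) (cvg_fst pA) (cvg_fst qB).
  by exists z.1.
apply: hY => A B pA qB.
have [z [Az Bz]] := pq (snd @^-1` A) (snd @^-1` B) (cvg_snd pA) (cvg_snd qB).
by exists z.2.
Qed.

Section Monothetic.
Context (G : topologicalType) (mul : G -> G -> G) (inv : G -> G) (one : G).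
Hypothesis HG : compact_group mul inv one.

Local Notation "x ** y" := (mul x y) (at level 40, left associativity).
Local Notation gpow := (gpow mul one).
Local Notation zpow := (zpow mul inv one).
Local Notation subgroup := (subgroup mul inv one).
Local Notation closed_subgroup := (closed_subgroup mul inv one).
Local Notation commutant := (commutant mul).

Lemma compact_group_prod : compact_group (pmul mul) (Defs.pinv inv) (one, one).
Proof.
split; first by move=> x y z; rewrite /pmul /= !(grpA HG).
split; first by move=> [x y]; rewrite /pmul /= !(grp1l HG) !(grp1r HG).
split; first by move=> [x y]; rewrite /pmul /Defs.pinv /= !(grpVl HG) !(grpVr HG).
split.
  move=> p; apply: cvg_pair.
    apply: (@continuous_mulG _ _ _ _ HG _ (fun p : (G * G) * (G * G) => p.1.1) (fun p => p.2.1)).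
      by move=> q; apply: (continuous_comp (f := fst) (g := fst)); exact: cvg_fst.
    by move=> q; apply: (continuous_comp (f := snd) (g := fst)); [exact: cvg_snd|exact: cvg_fst].
  apply: (@continuous_mulG _ _ _ _ HG _ (fun p : (G * G) * (G * G) => p.1.2) (fun p => p.2.2)).
    by move=> q; apply: (continuous_comp (f := fst) (g := snd)); [exact: cvg_fst|exact: cvg_snd].
  by move=> q; apply: (continuous_comp (f := snd) (g := snd)); exact: cvg_snd.
split.
  move=> p; apply: cvg_pair.
    by apply: (@continuous_invG _ _ _ _ HG _ fst) => q; exact: cvg_fst.
  by apply: (@continuous_invG _ _ _ _ HG _ snd) => q; exact: cvg_snd.
split; last by apply: hausdorff_prod; exact: (grp_hausdorff HG).
by rewrite -setXTT; apply: compact_setX; exact: (grp_compact HG).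
Qed.

Lemma closed_subgroup_fst (A : set G) : closed_subgroup A ->
  Defs.closed_subgroup (pmul mul) (Defs.pinv inv) (one, one) [set p : G * G | A p.1].
Proof.
move=> [[A1 AM AV] cA]; split; first by split=> //= [p q|p]; [exact: AM|exact: AV].
by apply: closed_comp cA => p _; exact: cvg_fst.
Qed.

Lemma closed_subgroup_snd (A : set G) : closed_subgroup A ->
  Defs.closed_subgroup (pmul mul) (Defs.pinv inv) (one, one) [set p : G * G | A p.2].
Proof.
move=> [[A1 AM AV] cA]; split; first by split=> //= [p q|p]; [exact: AM|exact: AV].
by apply: closed_comp cA => p _; exact: cvg_snd.
Qed.

Lemma closed_subgroup_commutant y : closed_subgroup (commutant y).
Proof. by split; [exact: (subgroup_commutant HG)|exact: (closed_commutant HG)]. Qed.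

Lemma closed_subgroupI A B : closed_subgroup A -> closed_subgroup B ->
  closed_subgroup (A `&` B).
Proof.
move=> [[A1 AM AV] cA] [[B1 BM BV] cB]; split; last exact: closedI.
by split=> // [x y [? ?] [? ?]|x [? ?]]; split; auto.
Qed.

Lemma subgroup_closure A : subgroup A -> closed_subgroup (closure A).
Proof.
move=> [A1 AM AV]; split; last exact: closed_closure.
split=> [|x y Ax Ay B|x Ax B].
- exact: subset_closure.
- move=> /(@grp_mul_continuous _ _ _ _ HG (x, y))[[V W] /= [xV yW] VW].
  have [a [Aa Va]] := Ax V xV; have [b [Ab Wb]] := Ay W yW.
  by exists (a ** b); split; [exact: AM|exact: (VW (a, b))].
- move=> /(@grp_inv_continuous _ _ _ _ HG x) => xB.
  have [a [Aa Va]] := Ax _ xB.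
  by exists (inv a); split=> //; exact: AV.
Qed.

Lemma zpow_1D x z : zpow x (1 + z) = x ** zpow x z.
Proof.
case: z => [n|[|n]] //=.
  by rewrite (grp1r HG) (grpVr HG).
rewrite subn1 [n.+1.-1]/=.
have e : x ** (x ** gpow x n) = (x ** gpow x n) ** x.
  by rewrite -gpowS; exact/esym/(gpow_comm HG).
by rewrite e [in RHS](grp_invM HG) (grpVK HG).
Qed.

Lemma zpow_natD x (m : nat) z : zpow x (m%:Z + z) = gpow x m ** zpow x z.
Proof.
elim: m => [|m IH]; first by rewrite add0r (grp1l HG).
by rewrite -addn1 addnC PoszD -addrA zpow_1D IH add1n gpowS (grpA HG).
Qed.

Lemma subgroup_zpow x : subgroup [set zpow x z | z in setT].
Proof.
split=> [|_ _ [a _ <-] [b _ <-]|_ [a _ <-]].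
- by exists 0.
- case: a => m; first by exists (m%:Z + b) => //; rewrite zpow_natD.
  (* A negative exponent is handled by cancelling [gpow x m.+1] on the left, which leaves a shift by
     a natural number. *)
  exists (b - m.+1%:Z) => //; apply: (grpI HG (x := gpow x m.+1)).
  by rewrite -zpow_natD addrC subrK /= -/(gpow x m.+1) (grpVK HG).
case: a => [[|m]|m].
- by exists 0 => //=; rewrite (grp_inv1 HG).
- by exists (Negz m).
- by exists (Posz m.+1) => //=; rewrite (grp_invK HG).
Qed.

Lemma closed_subgroup_monothetic x : closed_subgroup (monothetic mul inv one x).
Proof. exact/subgroup_closure/subgroup_zpow. Qed.

Lemma gpow_monothetic x n : monothetic mul inv one x (gpow x n).
Proof. by apply: subset_closure; exists (Posz n). Qed.

(** [C] may be any set, so that the union of centralizers in [commuting_pos_open] is covered as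
    well. *)
Lemma finite_index_or_sequence (C : set G) :
  (exists s : seq G, forall g, exists2 a, a \in s & C (inv a ** g)) \/
  exists f : nat -> G, forall i j, (i < j)%N -> ~ C (inv (f i) ** f j).
Proof.
have [|inf] := pselect (exists s : seq G, forall g, exists2 a, a \in s & C (inv a ** g)).
  by left.
right; have [|f [_ fP]] := @greedy_sequence _ (fun=> True) (fun a g => ~ C (inv a ** g)).
  move=> s _; apply: contrapT => nex; apply: inf; exists s => g.
  apply: contrapT => ng; apply: nex; exists g; split=> // a sa Ca.
  by apply: ng; exists a.
by exists f.
Qed.

(** If finitely many cosets cover [G], those other than [C] are closed and miss [one], so points
    near [one] lie in [C]. *)
Lemma closed_subgroup_index (C : set G) : closed_subgroup C ->
  nbhs one C \/ exists f : nat -> G, forall i j, (i < j)%N -> ~ C (inv (f i) ** f j).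
Proof.
move=> [[C1 CM CV] cC].
have [[s sP]|] := finite_index_or_sequence C; last by right.
left; have : \forall g \near one, forall a, a \in s -> ~ C a -> ~ C (inv a ** g).
  apply: near_seq => a _; have [Ca|nCa] := pselect (C a); first exact: nearW.
  have nCa' : ~ C (inv a ** one).
    by rewrite (grp1r HG) => /CV; rewrite (grp_invK HG).
  have near_nC : \forall g \near one, ~ C (inv a ** g).
    exact: (@continuous_lmul _ _ _ _ HG (inv a) one _
      (open_nbhs_nbhs (conj (closed_openC cC) nCa'))).
  by apply: filterS near_nC => g gC _.
apply: filterS => g gP; have [a sa Cag] := sP g.
have Ca : C a by apply: contrapT => /(gP a sa).
by rewrite -(grpVK HG a g); exact: CM.
Qed.

Lemma closed_commuting (H : set G) : closed H ->
  closed [set p : G * G | H p.1 /\ p.1 ** p.2 = p.2 ** p.1].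
Proof.
move=> cH; apply: closedI; first by apply: closed_comp cH => p _; exact: cvg_fst.
apply: (closed_equalizer (grp_hausdorff HG)); first exact: (grp_mul_continuous HG).
by apply: (continuous_mulG HG) => p; [exact: cvg_snd|exact: cvg_fst].
Qed.

Context (R : realType) (x : G).
Local Notation H := (monothetic mul inv one x).
Context (nu : set (G * G) -> R).
Hypothesis Hnu : haar_measure (pmul mul) [set p | H p.1] nu.
Local Notation commuting := [set p : G * G | H p.1 /\ p.1 ** p.2 = p.2 ** p.1].

Lemma commuting_pos_open : 0 < nu commuting ->
  exists2 n, (0 < n)%N & nbhs one (commutant (gpow x n)).
Proof.
move=> P0; apply: contrapT => nopen.
have HGG := compact_group_prod.
have [[H1 HM HV] cH] := closed_subgroup_monothetic x.
(* A closed centralizer that is not open has infinitely many cosets. *)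
have null_snd n : (0 < n)%N -> nu [set p | commutant (gpow x n) p.2] = 0.
  move=> n0; have [nb|[f fP]] := closed_subgroup_index (closed_subgroup_commutant (gpow x n)).
    by exfalso; apply: nopen; exists n.
  apply: (haar_null_subgroup HGG Hnu (f := fun i => (one, f i))) => //.
  exact/closed_subgroup_snd/closed_subgroup_commutant.
(* When [u] commutes with no positive power of [x], the powers of [x] lie in distinct cosets of
   [commutant u]. *)
have null_fst u : (forall n, (0 < n)%N -> ~ commutant u (gpow x n)) ->
    nu [set p | commutant u p.1] = 0.
  move=> uP; apply: (haar_null_subgroup HGG Hnu (f := fun i => (gpow x i, one))).
  - exact/closed_subgroup_fst/closed_subgroup_commutant.
  - by move=> i; exact: gpow_monothetic.
  move=> i j ij /=; rewrite -(subnKC (ltnW ij)) (gpowD HG) (grpK HG).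
  by apply: uP; rewrite subn_gt0.
pose E := [set g | exists2 n, (0 < n)%N & commutant (gpow x n) g].
have [[s sP]|[f fP]] := finite_index_or_sequence E.
  (* Finite index of [E]: countably many translates of the sets in [null_snd] would cover
     everything. The index [n] stands for the exponent [n.+1], which keeps exponents positive. *)
  suff : nu setT = 0 by case: Hnu => _ [_ [-> _]] /eqP; rewrite oner_eq0.
  apply: (haar_null_cover HGG Hnu (A := fun n => [set p | commutant (gpow x n.+1) p.2])
    (f := fun _ j => (one, nth one s j))) => //.
  - by move=> n; case: (closed_subgroup_snd (closed_subgroup_commutant (gpow x n.+1))).
  - by apply: borel_open; exact: openT.
  - by move=> n; exact: null_snd.
  move=> [h g] _; have [a sa [[//|n] _ En]] := sP g.
  exists n => //; exists (index a s) => //.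
  exists (h, inv a ** g) => //; rewrite /pmul /= (grp1l HG) nth_index// (grpVK HG).
  by [].
(* Infinite index of [E]: the translates of the commuting pairs by [(one, f i)] overlap in null
   sets. *)
suff : nu commuting = 0 by move=> e; move: P0; rewrite e ltxx.
apply: (haar_null_translates HGG Hnu (f := fun i => (one, f i))) => //.
  exact: closed_commuting.
move=> i j ij; have cP := closed_commuting cH.
have [nu_ge0 [nu_sigma _]] := Hnu.
have cI : closed ([set pmul mul (one, f i) a | a in commuting] `&`
    [set pmul mul (one, f j) a | a in commuting]).
  by apply: closedI; exact: (closed_lmul HGG).
have [_ cU] := closed_subgroup_fst (closed_subgroup_commutant (inv (f i) ** f j)).
apply/eqP; rewrite eq_le nu_ge0 ?andbT; last exact: borel_closed.
rewrite -(null_fst (inv (f i) ** f j)).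
  apply: (bmeasure_mono nu_ge0 nu_sigma); try exact: borel_closed.
  (* A common point makes [g] and [g'] commute with the same [h]; so does [g ** inv g'], which is
     [inv (f i) ** f j]. *)
  move=> _ [[[h g] [/= Hh hg] <-] [[h' g'] [/= _ h'g'] /pair_equal_spec[/=]]].
  rewrite !(grp1l HG) => e1 e2; rewrite {}e1 in h'g'.
  have -> : inv (f i) ** f j = g ** inv g'.
    by apply: (grpI HG (x := f i)); rewrite (grpVK HG) (grpA HG) -e2 (grprK HG).
  rewrite /commutant /=; apply/esym/(grp_commM HG) => //.
  exact/(grp_commV HG)/esym.
by move=> n n0 xn; apply: (fP i j ij); exists n.
Qed.

(** Let [L] be the centralizer of [T] in [<x>]. The sets [gpow x i ** L] with [i < n] cover [<x>],
    finitely many translates of [T] cover [G], and pairs from [L] and [T] commute. So finitely many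
    translates of the commuting pairs cover a set of mass [1]. *)
Lemma open_commuting_pos (T : set G) n : nbhs one T -> (0 < n)%N ->
  (forall t, T t -> gpow x n ** t = t ** gpow x n) -> 0 < nu commuting.
Proof.
move=> T1 n0 nT; have HGG := compact_group_prod.
have [[H1 HM HV] cH] := closed_subgroup_monothetic x.
have [nu_ge0 [_ [_ [nuH _]]]] := Hnu.
have cP := closed_commuting cH.
rewrite lt_neqAle nu_ge0 ?andbT; last exact: borel_closed.
apply/eqP => /esym nuP0.
pose L := H `&` [set h | forall t, T t -> h ** t = t ** h].
have [[L1 LM LV] cL] : closed_subgroup L.
  apply: closed_subgroupI; first exact: closed_subgroup_monothetic.
  split; first split=> /= [t _|a b aT bT t Tt|a aT t Tt].
  - by rewrite (grp1l HG) (grp1r HG).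
  - by apply: (grp_commM HG); auto.
  - by apply: (grp_commV HG); auto.
  rewrite (_ : [set h | _] = \bigcap_(t in T) commutant t); last by [].
  by apply: closed_bigI => t _; exact: (closed_commutant HG).
have Lxn : L (gpow x n) by split=> //; exact: gpow_monothetic.
have Lpow q : L (gpow (gpow x n) q) by elim: q => [//|q IH]; exact: LM.
(* A finite union of closed sets, so it contains [<x>] as soon as it contains all integral powers of
   [x]. *)
pose M := \bigcup_(i < n) [set gpow x i ** l | l in L].
have cM : closed M.
  rewrite /M bigcup_mkord; elim/big_ind: _ => [|A B|i _]; first exact: closed0.
    exact: closedU.
  exact: (closed_lmul HG).
have Mpos k : M (gpow x k).
  exists (k %% n)%N; first by rewrite /= ltn_mod.
  exists (gpow (gpow x n) (k %/ n)) => //.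
  by rewrite -(gpowM HG) -(gpowD HG) addnC mulnC -divn_eq.
have MZ : [set zpow x z | z in setT] `<=` M.
  move=> _ [[k|k] _ <-]; first exact: Mpos.
  (* Adding [n * k.+1] makes the negative exponent natural; the shift is undone inside [L], which
     contains the powers of [gpow x n]. *)
  have [i ilt [l Ll e]] := Mpos (n * k.+1 - k.+1)%N.
  have kn : (k.+1 <= n * k.+1)%N by rewrite leq_pmull.
  exists i => //; exists (l ** inv (gpow (gpow x n) k.+1)).
    by apply: LM => //; exact: LV.
  rewrite (grpA HG) e -(gpowM HG) -[in inv (gpow x (n * k.+1))](subnKC kn) (gpowD HG x k.+1).
  by rewrite (grp_invM HG) (grpVK HG).
have HM' : H `<=` M by move=> h /(closure_subset MZ)/cM.
have [s _ sP] := finite_translate_cover HG setT T1.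
suff : nu [set p | H p.1] = 0 by rewrite nuH => /eqP; rewrite oner_eq0.
(* The family is indexed by all of [nat]; beyond the list [nth] returns [one], which only adds
   further translates. *)
apply: (haar_null_cover HGG Hnu (A := fun=> commuting)
  (f := fun i j => (gpow x i, nth one s j))) => //.
- by apply: borel_closed; case: (closed_subgroup_fst (closed_subgroup_monothetic x)).
- by move=> i j; exact: gpow_monothetic.
move=> [h g] /= /HM'[i _ [l [Hl lT] e]].
have [a sa Ta] := sP g Logic.I.
exists i => //; exists (index a s) => //; exists (l, inv a ** g).
  by split=> //=; exact: lT.
by rewrite /pmul /= nth_index// (grpVK HG) e.
Qed.

End Monothetic.

(** * Positivity of [Pr] and torsion of the quotient *)

Theorem theorem1p1 (R : realType) (G : topologicalType)
  (mul : G -> G -> G) (inv : G -> G) (one : G)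
  (HG : compact_group mul inv one)
  (K : set G) (HK : closed_subgroup mul inv one K) :
  (forall x, K x -> 0 < Pr R mul inv one (monothetic mul inv one x)) <->
  (exists T : set G, [/\ open T, normal_subgroup mul inv one T &
      quotient_torsion mul one K (centralizer_in mul K T)]).
Proof.
(* Existence on the product group guarantees that the Hilbert choice in [haar_prod] is a Haar
   measure. *)
have haarP x : haar_measure (pmul mul) [set p | monothetic mul inv one x p.1]
    (haar_prod R mul inv one (monothetic mul inv one x)).
  apply: ClassicalEpsilon.epsilon_spec.
  apply: (haar_measure_exists _ (compact_group_prod HG)).
  exact/closed_subgroup_fst/(closed_subgroup_monothetic HG).
split=> [pos|[T [oT nT tors]] x Kx].
  apply: (uniform_centralizer HG HK) => x /pos.
  exact: (commuting_pos_open HG (haarP x)).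
have [n [n0 [_ xnT]]] := tors x Kx.
apply: (open_commuting_pos HG (haarP x) (T := T)) n0 xnT.
by apply: open_nbhs_nbhs; split=> //; case: nT => -[].
Qed.
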